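(* Any solution $(x,\lambda):[0,+\infty)\to G\times\mathbb{R}^p$ of the saddle-point-like dynamics $$\dot x\in P_{T_G(x)}(F(x,\lambda)),\qquad\dot\lambda=h(x),$$ starting from a point in $G\times\mathbb{R}^p$ converges asymptotically (as $t\to+\infty$) to a point in the set $S\times\mathbb{R}^p$, where $S\subset\mathbb{R}^n$ is the set of solutions of $\min\{f(x)\mid h(x)=0_p,\ g(x)\le0_m\}$.
   Context: Setting: $f:\mathbb{R}^n\to\mathbb{R}$ is convex, $g=(g_1,\dots,g_m):\mathbb{R}^n\to\mathbb{R}^m$ is (componentwise) convex, neither necessarily differentiable, and $h(x)=Ax-b$ with $A\in\mathbb{R}^{p\times n}$, $b\in\mathbb{R}^p$, $p\le n$. Let $C=\{x\mid h(x)=0_p,\ g(x)\le0_m\}$ and $S=\{x^\star\in C\mid f(x^\star)=\inf_Cf\}$. Standing assumptions: $S$ is nonempty and bounded; (A1) $\mathrm{rank}(A)=p$; (A2) there is $x\in\mathbb{R}^n$ with $h(x)=0_p$ and $g_k(x)<0$ for all $k\in\{1,\dots,m\}$. The parameter $\mu>0$ is fixed. $G=\{x\in\mathbb{R}^n\mid g(x)\le0_m\}$ (closed and convex). The set-valued map $F:G\times\mathbb{R}^p\rightrightarrows\mathbb{R}^n$ is $$F(x,\lambda)=-\tfrac1\mu A^\top(Ax-b)-A^\top\lambda-\partial f(x),$$ with $\partial f$ the convex subdifferential. For $x\in G$ and a nonempty convex compact set $K\subset\mathbb{R}^n$, $$P_{T_G(x)}(K)=\bigcup_{\xi\in K}\lim_{\delta\searrow0}\frac{\mathrm{proj}_G(x+\delta\xi)-x}{\delta},$$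 where $\mathrm{proj}_G$ is the Euclidean projection onto $G$; equivalently, it is the set of Euclidean projections of elements of $K$ onto the tangent cone $T_G(x)=\mathrm{cl}\,\mathbb{R}_{\ge0}(G-x)$. A solution is a (locally) absolutely continuous curve with values in $G\times\mathbb{R}^p$ satisfying the inclusion for almost every $t$. *)

(* Defs.v *)
From HB Require Import structures.
From mathcomp Require Import all_boot all_order all_algebra.
From mathcomp Require Import all_classical all_reals all_analysis.

Set Implicit Arguments.
Unset Strict Implicit.
Unset Printing Implicit Defensive.

Import Order.TTheory GRing.Theory Num.Theory.
Import numFieldNormedType.Exports.

Local Open Scope classical_set_scope.
Local Open Scope ring_scope.

Section Euclidean.
Context {R : realType} {n : nat}.
Implicit Types (x y z : 'cV[R]_n) (G K : set 'cV[R]_n).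

Definition dotv x y : R := \sum_(i < n) x i ord0 * y i ord0.

(* The library norm `|x| of a column vector is the sup norm; it induces the
   usual topology, but projections and subgradients are Euclidean. *)
Definition norm2 x : R := Num.sqrt (dotv x x).

Definition is_proj G y z : Prop :=
  G z /\ forall w, G w -> norm2 (y - z) <= norm2 (y - w).

(* If G is nonempty, closed and convex, there is exactly one z with
   is_proj G y z, so that the default value y of xget is never used. *)
Definition euclid_proj G y : 'cV[R]_n := xget y [set z | is_proj G y z].

Definition proj_tangent G x K : set 'cV[R]_n :=
  [set v | exists2 xi, K xi &
    (fun delta : R => delta^-1 *: (euclid_proj G (x + delta *: xi) - x))
      @ 0^'+ --> v].

Definition subdifferential (f : 'cV[R]_n -> R) x : set 'cV[R]_n :=
  [set s | forall y, f x + dotv s (y - x) <= f y].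

Definition abs_continuous (s t : R) (u : R -> 'cV[R]_n) : Prop :=
  forall eps : R, 0 < eps -> exists2 delta : R, 0 < delta &
    forall (N : nat) (a b : 'I_N -> R),
      (forall i, [/\ s <= a i, a i <= b i & b i <= t]) ->
      trivIset [set: 'I_N] (fun i => `]a i, b i[%classic) ->
      \sum_(i < N) (b i - a i) < delta ->
      \sum_(i < N) `|u (b i) - u (a i)| < eps.

(* Curves on [0, +oo[ are functions on R, of which only the values at
   nonnegative times matter. *)
Definition loc_abs_continuous (u : R -> 'cV[R]_n) : Prop :=
  forall t : R, 0 < t -> abs_continuous 0 t u.

End Euclidean.

Section Problem.
Context {R : realType} {n m p : nat}.
Variables (f : 'cV[R]_n -> R) (g : 'cV[R]_n -> 'cV[R]_m).
Variables (A : 'M[R]_(p, n)) (b : 'cV[R]_p).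

Definition eq_constraint (x : 'cV[R]_n) : 'cV[R]_p := A *m x - b.

Definition ineq_set : set 'cV[R]_n :=
  [set x | forall k : 'I_m, g x k ord0 <= 0].

Definition feasible_set : set 'cV[R]_n :=
  [set x | eq_constraint x = 0] `&` ineq_set.

(* The infimum is taken in the extended reals: the real-valued inf of a set
   that is not bounded below is the junk value 0. *)
Definition solution_set : set 'cV[R]_n :=
  [set x | feasible_set x /\
    (f x)%:E = ereal_inf [set (f y)%:E | y in feasible_set]].

Definition saddle_map (mu : R) (x : 'cV[R]_n) (lam : 'cV[R]_p) :
    set 'cV[R]_n :=
  [set - (mu^-1 *: (A^T *m (A *m x - b))) - A^T *m lam - s
    | s in subdifferential f x].

Record saddle_solution (mu : R) (x : R -> 'cV[R]_n) (lam : R -> 'cV[R]_p) :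
    Prop := SaddleSolution {
  saddle_solution_in : forall t : R, 0 <= t -> ineq_set (x t);
  saddle_solution_acx : loc_abs_continuous x;
  saddle_solution_acl : loc_abs_continuous lam;
  saddle_solution_ae : {ae (@lebesgue_measure R), forall t : R, 0 <= t ->
    [/\ derivable x t 1, derivable lam t 1,
        proj_tangent ineq_set (x t) (saddle_map mu (x t) (lam t)) (derive1 x t) &
        derive1 lam t = eq_constraint (x t)]}
}.

End Problem.

(* Main.v *)
Require Import Defs.
From HB Require Import structures.
From mathcomp Require Import all_boot all_order all_algebra.
From mathcomp Require Import all_classical all_reals all_analysis.
From mathcomp Require Import ring lra.

Set Implicit Arguments.
Unset Strict Implicit.
Unset Printing Implicit Defensive.

Import Order.TTheory GRing.Theory Num.Theory.
Import numFieldNormedType.Exports.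

Local Open Scope classical_set_scope.
Local Open Scope ring_scope.

(** Write h x = A x - b and let G be the set of points satisfying the inequality
    constraints. For y in G and any nu put
    W t = (|x t - y|^2 + |lam t - nu|^2) / 2. Since xi - v is normal to G at x
    when v is the projection of xi on the tangent cone, the subgradient
    inequality gives, at almost every time,
    W' <= f y - f x + <lam, h y> - <nu, h x> - <h x - h y, h x> / mu
    ([saddle_map_rate]). The curve being absolutely continuous, W decreases at
    least as fast as any constant bound on the right-hand side dictates
    ([energy_decrease]); everything below follows from choices of y and nu.

    By Slater's condition and the full rank of A there is a multiplier ls for
    a given minimizer xs ([multiplier_exists]). With (y, nu) = (xs, ls) the
    rate is nonpositive, so W is nonincreasing and the curve is bounded. As W
    is nonnegative, the rate comes arbitrarily close to zero at arbitrarily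
    large times, and a limit point (xb, lb) of the curve along such times has
    h xb = 0 and f xb = f xs, that is, xb is a minimizer
    ([sol_limit_point]).

    The point that needs care is that lb is again a multiplier
    ([limit_multiplier]). Shifting nu away from ls by a small multiple of a
    vector u shows that <lam, u> varies arbitrarily little over time windows of
    any fixed length, once the windows start late enough ([dual_drift]). If
    f y + <lb, h y> < f xs for some y in G, then the energy
    centred at y and ls + h y / mu would decrease at a fixed rate over windows
    of arbitrary length that start near lb, and would become negative.

    Hence (xb, lb) is a saddle point too, the energy centred there is
    nonincreasing, and it is arbitrarily small at some times: the curve
    converges to (xb, lb). *)

(** * The Euclidean dot product on column vectors *)

Lemma lipschitz_at_continuous {R : realType} {V W : normedModType R} (C : R)
    (F : V -> W) (x : V) :
  (forall d, `|d| <= 1 -> `|F (x + d) - F x| <= C * `|d|) ->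
  {for x, continuous F}.
Proof.
move=> FC; apply/cvgrPdist_le => /= e e0; near=> y.
have y1 : `|y - x| <= 1.
  by rewrite distrC; near: y; apply: (@cvgr_dist_le _ _ _ _ _ id x).
have : `|y - x| <= e / (`|C| + 1).
  rewrite distrC; near: y; apply: (@cvgr_dist_le _ _ _ _ _ id x) => //.
  by rewrite divr_gt0// ltr_wpDl.
rewrite ler_pdivlMr ?ltr_wpDl// => ye.
rewrite distrC -[in F y](subrK x y) (addrC _ x); apply: le_trans (FC _ y1) _.
apply: le_trans ye; rewrite mulrC ler_wpM2l//.
by rewrite (le_trans (ler_norm _))// lerDl.
Unshelve. all: by end_near. Qed.

Lemma lipschitz_continuous {R : realType} {V W : normedModType R} (C : R)
    (F : V -> W) :
  (forall u v, `|F u - F v| <= C * `|u - v|) -> continuous F.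
Proof.
move=> FC x; apply: (@lipschitz_at_continuous _ _ _ C) => d _.
by rewrite (le_trans (FC _ _))// addrAC subrr add0r.
Qed.

Section DotProduct.
Context {R : realType} {n : nat}.
Implicit Types u v w : 'cV[R]_n.

Lemma dotvC u v : dotv u v = dotv v u.
Proof. by apply: eq_bigr => i _; rewrite mulrC. Qed.

Lemma dotvDl u v w : dotv (u + v) w = dotv u w + dotv v w.
Proof. by rewrite -big_split; apply: eq_bigr => i _; rewrite mxE mulrDl. Qed.

Lemma dotvNl u w : dotv (- u) w = - dotv u w.
Proof.
by rewrite /dotv -sumrN; apply: eq_bigr => i _; rewrite mxE mulNr.
Qed.

Lemma dotvZl (a : R) u w : dotv (a *: u) w = a * dotv u w.
Proof. by rewrite /dotv mulr_sumr; apply: eq_bigr => i _; rewrite mxE mulrA. Qed.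

Lemma dotvDr u v w : dotv w (u + v) = dotv w u + dotv w v.
Proof. by rewrite dotvC dotvDl !(dotvC w). Qed.

Lemma dotvNr u w : dotv w (- u) = - dotv w u.
Proof. by rewrite dotvC dotvNl (dotvC w). Qed.

Lemma dotvZr (a : R) u w : dotv w (a *: u) = a * dotv w u.
Proof. by rewrite dotvC dotvZl (dotvC w). Qed.

Definition dotvE := (dotvDl, dotvDr, dotvNl, dotvNr, dotvZl, dotvZr).

Lemma dotv0l u : dotv 0 u = 0.
Proof. by rewrite -(scale0r u) dotvZl mul0r. Qed.

Lemma dotv0r u : dotv u 0 = 0.
Proof. by rewrite dotvC dotv0l. Qed.

Lemma dotv_ge0 u : 0 <= dotv u u.
Proof. by apply: sumr_ge0 => i _; rewrite -expr2 sqr_ge0. Qed.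

Lemma ler_norm2 u v : (norm2 u <= norm2 v) = (dotv u u <= dotv v v).
Proof. by rewrite ler_sqrt // dotv_ge0. Qed.

Lemma le_coord_norm u i : `|u i ord0| <= `|u|.
Proof.
rewrite [leRHS]/Num.Def.normr/= mx_normrE.
exact: (le_bigmax _ (fun ij => `|u ij.1 ij.2|) (i, ord0)).
Qed.

Lemma norm_le_coord u (M : R) :
  0 <= M -> (forall i, `|u i ord0| <= M) -> `|u| <= M.
Proof.
move=> M0 uM; rewrite [leLHS]/Num.Def.normr/= mx_normrE.
by rewrite (bigmax_le _ M0)//= => -[i j] _ /=; rewrite (ord1 j).
Qed.

Lemma dotv_bound u v : `|dotv u v| <= n%:R * (`|u| * `|v|).
Proof.
apply: (le_trans (ler_norm_sum _ _ _)).
rewrite (@le_trans _ _ (\sum_(i < n) `|u| * `|v|))//.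
  by apply: ler_sum => i _; rewrite normrM ler_pM// le_coord_norm.
by rewrite sumr_const card_ord -[leLHS]mulr_natl.
Qed.

Lemma sqr_norm_le_dotv u : `|u| ^+ 2 <= dotv u u.
Proof.
suff h : `|u| <= Num.sqrt (dotv u u).
  by rewrite -[leRHS]sqr_sqrtr ?dotv_ge0// lerXn2r// nnegrE ?sqrtr_ge0.
apply: norm_le_coord => [|i]; first exact: sqrtr_ge0.
rewrite -sqrtr_sqr ler_sqrt ?dotv_ge0// /dotv (bigD1 i)//= -expr2 lerDl.
by apply: sumr_ge0 => j _; rewrite -expr2 sqr_ge0.
Qed.

Lemma dotv_eq0 u : dotv u u <= 0 -> u = 0.
Proof.
move=> u0; apply/eqP; rewrite -normr_eq0 -sqrf_eq0 eq_le sqr_ge0 andbT.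
exact: le_trans (sqr_norm_le_dotv _) u0.
Qed.

(** The closed balls of the sup norm are images under transposition of
    products of segments. *)
Lemma compact_cV_ball (M : R) : compact [set u : 'cV[R]_n | `|u| <= M].
Proof.
have [M0|M0] := ltP M 0.
  rewrite (_ : mkset _ = set0); first exact: compact0.
  by apply/seteqP; split=> // u /= uM; move: (normr_ge0 u); lra.
pose K := [set v : 'rV[R]_n | forall i, v ord0 i \in `[(- M), M]].
have cK : compact K.
  apply: (@rV_compact _ _ (fun=> `[(- M), M]%classic)).
  by move=> _; exact: segment_compact.
rewrite (_ : mkset _ = trmx @` K).
  apply: continuous_compact cK; apply: continuous_subspaceT.
  apply: (@lipschitz_continuous _ _ _ 1) => v w; rewrite mul1r.
  apply: norm_le_coord => // i; rewrite -linearB/= mxE.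
  rewrite [leRHS]/Num.Def.normr/= mx_normrE.
  exact: (le_bigmax _ (fun ij => `|(v - w) ij.1 ij.2|) (ord0, i)).
apply/seteqP; split=> [u /= uM|_ /= [v Kv <-]].
  exists u^T; last exact: trmxK.
  move=> i; rewrite mxE in_itv/= -ler_norml.
  exact: le_trans (le_coord_norm _ _) uM.
by apply: norm_le_coord => // i; rewrite mxE ler_norml; exact: Kv.
Qed.

End DotProduct.

Lemma dotv_trmx {R : realType} {n p : nat} (A : 'M[R]_(p, n)) u v :
  dotv (A^T *m u) v = dotv u (A *m v).
Proof.
rewrite /dotv; under eq_bigr do rewrite mxE mulr_suml.
rewrite exchange_big; apply: eq_bigr => i _; rewrite mxE mulr_sumr.
by apply: eq_bigr => j _; rewrite mxE mulrCA mulrA.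
Qed.

Section Continuity.
Context {R : realType} {n : nat}.

Lemma mulmx_bounded {p} (A : 'M[R]_(p, n)) :
  exists2 C : R, 0 <= C & forall v : 'cV[R]_n, `|A *m v| <= C * `|v|.
Proof.
pose C : R := n%:R * \big[Num.max/0]_i `|(row i A)^T|.
have C0 : 0 <= C by rewrite mulr_ge0//; exact: bigmax_ge_id.
exists C => // v; apply: norm_le_coord => [|i]; first by rewrite mulr_ge0.
have -> : (A *m v) i ord0 = dotv (row i A)^T v.
  by rewrite mxE; apply: eq_bigr => j _; rewrite !mxE.
apply: (le_trans (dotv_bound _ _)); rewrite mulrA ler_wpM2r//.
by rewrite ler_wpM2l// (le_bigmax _ (fun i => `|(row i A)^T|)).
Qed.

Lemma cvg_dotv {T : Type} {F : set_system T} {FF : Filter F}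
    (u v : T -> 'cV[R]_n) (a b : 'cV[R]_n) :
  u @ F --> a -> v @ F --> b -> dotv (u t) (v t) @[t --> F] --> dotv a b.
Proof.
have c i (w : T -> 'cV[R]_n) (l : 'cV[R]_n) :
    w @ F --> l -> w t i ord0 @[t --> F] --> l i ord0.
  move=> wl; apply: (@cvg_comp _ _ _ w (fun v : 'cV[R]_n => v i ord0)) wl _.
  exact: coord_continuous.
move=> ua vb; rewrite /dotv; apply: cvg_big => [|i _]; first exact: add_continuous.
by apply: cvgM; exact: c.
Qed.

Lemma dotv_continuous {T : topologicalType} (u v : T -> 'cV[R]_n) (x : T) :
  {for x, continuous u} -> {for x, continuous v} ->
  {for x, continuous (fun t => dotv (u t) (v t))}.
Proof. by move=> cu cv; exact: cvg_dotv. Qed.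

End Continuity.

(** * Continuity of convex functions *)

Section Convexity.
Context {R : realType} {n : nat}.
Implicit Types (f : 'cV[R]_n -> R) (x y d : 'cV[R]_n).

Lemma convex_le f x y (t : R) : convex_function [set: 'cV[R]_n] f ->
  0 <= t -> t <= 1 ->
  f (t *: x + (1 - t) *: y) <= t * f x + (1 - t) * f y.
Proof.
move=> fc t0 t1; have t01 : (0 <= t <= 1)%R by rewrite t0 t1.
exact: (fc (Itv01 t0 t1) x y (in_setT x) (in_setT y)).
Qed.

(** One coordinate at a time: a point whose [k]-th coordinate lies in
    [-1, 1] is a convex combination of the two points obtained by moving that
    coordinate to the end points of the segment. *)
Lemma convex_bounded_cube f : convex_function [set: 'cV[R]_n] f ->
  forall x, exists M, forall d, `|d| <= 1 -> f (x + d) <= M.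
Proof.
move=> fc x0.
suff H k x : exists M, forall d, `|d| <= 1 ->
    (forall i : 'I_n, (k <= i)%N -> d i ord0 = 0) -> f (x + d) <= M.
  have [M fM] := H n x0; exists M => d d1; apply: fM => // i.
  by rewrite leqNgt ltn_ord.
elim: k x => [|k IH] x.
  exists (f x) => d _ d0; rewrite (_ : d = 0) ?addr0//.
  by apply/colP => i; rewrite d0// mxE.
have [kn|nk] := ltnP k n; last first.
  have [M fM] := IH x; exists M => d d1 dk; apply: fM => // i ki.
  by move: (ltn_ord i); rewrite ltnNge (leq_trans nk ki).
pose e : 'cV[R]_n := delta_mx (Ordinal kn) ord0.
have [M1 fM1] := IH (x + e); have [M2 fM2] := IH (x - e).
exists (Num.max M1 M2) => d d1 dk.
pose s : R := d (Ordinal kn) ord0.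
have s1 : `|s| <= 1 by exact: le_trans (le_coord_norm _ _) d1.
have [s1l s1u] : -1 <= s /\ s <= 1 by move: s1; rewrite ler_norml => /andP[].
pose d' : 'cV[R]_n := d - s *: e.
have d'E i : d' i ord0 = if i == Ordinal kn then 0 else d i ord0.
  rewrite !mxE eqxx andbT; case: eqP => [->|_]; last by rewrite mulr0 subr0.
  by rewrite mulr1 subrr.
have d'1 : `|d'| <= 1.
  apply: norm_le_coord => // i; rewrite d'E; case: ifP => _.
    by rewrite normr0.
  exact: le_trans (le_coord_norm _ _) d1.
have d'0 (i : 'I_n) : (k <= i)%N -> d' i ord0 = 0.
  move=> ki; rewrite d'E; case: eqP => // /eqP ik; apply: dk.
  by rewrite ltn_neqAle ki andbT; apply: contra ik => /eqP ik; apply/eqP/val_inj.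
have -> : x + d = ((1 + s) / 2) *: (x + e + d') +
                  (1 - (1 + s) / 2) *: (x - e + d').
  by apply/colP => i; rewrite /d' !mxE; field.
apply: le_trans (convex_le _ _ fc _ _) _; [lra|lra|].
have h1 : f (x + e + d') <= Num.max M1 M2 by rewrite le_max fM1.
have h2 : f (x - e + d') <= Num.max M1 M2 by rewrite le_max fM2// orbT.
nra.
Qed.

(** An upper bound on a cube around [x] gives, by convexity along the lines
    through [x], a Lipschitz estimate at [x]. *)
Lemma convex_continuous f : convex_function [set: 'cV[R]_n] f -> continuous f.
Proof.
move=> fc x; have [M fM] := convex_bounded_cube fc x.
have C0 : 0 <= M - f x.
  by have := fM 0; rewrite normr0 addr0 ler01 subr_ge0; exact.
have fL d : `|d| <= 1 -> `|f (x + d) - f x| <= (M - f x) * `|d|.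
  move=> d1; have [->|d0] := eqVneq d 0.
    by rewrite addr0 subrr !normr0 mulr0.
  pose t := `|d|; pose u := t^-1 *: d.
  have t0 : 0 < t by rewrite normr_gt0.
  have tV := @divff _ t (lt0r_neq0 t0).
  have u1 : `|u| <= 1.
    by rewrite /u normrZ gtr0_norm ?invr_gt0// mulrC tV.
  have dE : d = t *: u by rewrite /u scalerA tV scale1r.
  have f1 : f (x + d) <= t * f (x + u) + (1 - t) * f x.
    have -> : x + d = t *: (x + u) + (1 - t) *: x.
      by rewrite {1}dE; apply/colP => i; rewrite !mxE; ring.
    exact: (convex_le _ _ fc (ltW t0) d1).
  have f2 : (1 + t) * f x <= f (x + d) + t * f (x - u).
    pose a := (1 + t)^-1.
    have aV : a * (1 + t) = 1 by rewrite mulVf// lt0r_neq0// ltr_wpDl.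
    have a0 : 0 < a by rewrite invr_gt0 ltr_wpDl.
    have a1 : a <= 1 by nra.
    have xE : x = a *: (x + d) + (1 - a) *: (x - u).
      have -> : 1 - a = a * t by move: aV; lra.
      rewrite {1}dE -scalerA -scalerDr.
      have -> : x + t *: u + t *: (x - u) = (1 + t) *: x.
        by apply/colP => i; rewrite !mxE; ring.
      by rewrite scalerA aV scale1r.
    have := convex_le (x + d) (x - u) fc (ltW a0) a1; rewrite -xE => h.
    have -> : t = (1 + t) * (1 - a) by move: aV; lra.
    have -> : (1 + (1 + t) * (1 - a)) = 1 + t by move: aV; lra.
    have -> : f (x + d) = (1 + t) * (a * f (x + d)).
      by rewrite mulrA (mulrC _ a) aV mul1r.
    by rewrite -mulrA -mulrDr ler_wpM2l// ltW// ltr_wpDl.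
  have h1 := fM u u1; have h2 : f (x - u) <= M by apply: fM; rewrite normrN.
  by rewrite ler_norml -/t; apply/andP; split; nra.
exact: lipschitz_at_continuous fL.
Qed.

End Convexity.

(** * Limit points and Lagrange multipliers *)

Section FamilyLimit.
Context {R : realType} {T : normedModType R}.
Implicit Types (K : set T) (E : R -> set T) (z : T).

(** [z] is a limit point of the family [E] as its index tends to [0]. *)
Definition family_limit E z := forall e, 0 < e -> exists2 y, E e y & `|z - y| < e.

(** The sets [E e] form a filter base, which has a cluster point in [K]. *)
Lemma compact_family_limit K E : compact K ->
  (forall e, 0 < e -> E e !=set0) ->
  (forall e e', 0 < e -> e <= e' -> E e `<=` E e') ->
  (forall e, E e `<=` K) ->
  exists2 z, K z & family_limit E z.
Proof.
move=> cK E0 Emono EK; pose F := filter_from [set e : R | 0 < e] E.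
have FF : ProperFilter F.
  apply: filter_from_proper; last by move=> e /= /E0.
  apply: filter_from_filter; first by exists 1 => /=.
  move=> e e' /= e0 e'0; exists (Num.min e e'); first by rewrite /= lt_min e0.
  by move=> y Ey; split; apply: Emono Ey; rewrite ?lt_min ?e0 ?ge_min ?lexx ?orbT.
have FK : F K by exists 1 => /=.
have [z [Kz Fz]] := cK F FF FK; exists z => // e e0.
have [|y [Ey zy]] := Fz (E e) (ball z e) _ (nbhsx_ballx _ _ e0).
  by exists e.
by exists y => //; move: zy; rewrite -ball_normE.
Qed.

(** How estimates along a family pass to its limit points: the bound need only
    vanish with the index. *)
Lemma family_limit_le0 E z (phi : T -> R) (c : R) : family_limit E z ->
  {for z, continuous phi} ->
  (forall e y, 0 < e -> E e y -> phi y <= c * e) -> phi z <= 0.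
Proof.
move=> Ez cphi phiE; rewrite leNgt; apply/negP => p0.
have : \forall y \near z, `|phi z - phi y| < phi z / 2.
  by apply: cvgr_dist_lt => //; rewrite divr_gt0.
move=> /nbhs_normP[r /= r0 zr].
have c1 : 0 < `|c| + 1 by rewrite ltr_wpDl.
pose e := Num.min r (phi z / 2 / (`|c| + 1)).
have e0 : 0 < e by rewrite lt_min r0 !divr_gt0.
have [y Ey zy] := Ez _ e0.
have {}zr : `|phi z - phi y| < phi z / 2.
  by apply: zr; rewrite /ball_ /= (lt_le_trans zy)// ge_min lexx.
have : (`|c| + 1) * e <= phi z / 2.
  by rewrite mulrC -ler_pdivlMr// ge_min lexx orbT.
have := phiE _ _ e0 Ey; have := ler_norm c; move: zr; rewrite ltr_norml.
move=> /andP[_]; nra.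
Qed.

End FamilyLimit.

Lemma le0_of_le_mul {R : realFieldType} (a c : R) :
  (forall t, 0 < t -> t <= 1 -> a <= t * c) -> a <= 0.
Proof.
move=> h; rewrite leNgt; apply/negP => a0.
have c1 : 0 < `|c| + 1 by rewrite ltr_wpDl.
pose t := Num.min 1 (a / 2 / (`|c| + 1)).
have t0 : 0 < t by rewrite lt_min ltr01 !divr_gt0.
have t1 : t <= 1 by rewrite ge_min lexx.
have : (`|c| + 1) * t <= a / 2.
  by rewrite mulrC -ler_pdivlMr// ge_min lexx orbT.
have := h t t0 t1; have := ler_norm c; nra.
Qed.

Section Multiplier.
Context {R : realType} {n p : nat}.
Variables (f : 'cV[R]_n -> R) (G : set 'cV[R]_n).
Variables (A : 'M[R]_(p, n)) (b : 'cV[R]_p).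
Hypothesis f_convex : convex_function [set: 'cV[R]_n] f.
Hypothesis G_convex : forall x y (t : R), G x -> G y -> 0 <= t -> t <= 1 ->
  G (t *: x + (1 - t) *: y).
Let h := eq_constraint A b.

Lemma eq_constraint_conv x y (t : R) :
  h (t *: x + (1 - t) *: y) = t *: h x + (1 - t) *: h y.
Proof.
rewrite /h /eq_constraint mulmxDr -!scalemxAr !scalerBr addrACA -opprD.
by rewrite -scalerDl (addrC t) subrK scale1r.
Qed.

Lemma eq_constraint_continuous : continuous h.
Proof.
have [C _ AC] := mulmx_bounded A.
apply: (@lipschitz_continuous _ _ _ C) => u v.
by rewrite opprB addrA subrK -mulmxBr.
Qed.

(** First-order optimality condition of the quadratic penalty problem:
    [k *: h y] plays the role of a Lagrange multiplier at a minimizer [y]. *)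
Lemma penalty_optimality (D : set 'cV[R]_n) (k : R) y :
  (forall x y (t : R), D x -> D y -> 0 <= t -> t <= 1 ->
     D (t *: x + (1 - t) *: y)) ->
  D y ->
  (forall z, D z ->
     f y + k / 2 * dotv (h y) (h y) <= f z + k / 2 * dotv (h z) (h z)) ->
  forall z, D z ->
    f y + k * dotv (h y) (h y) <= f z + dotv (k *: h y) (h z).
Proof.
move=> D_convex Dy ymin z Dz.
have [w hzE] : exists w, h z = h y + w by exists (h z - h y); rewrite addrC subrK.
rewrite -subr_le0; apply: (@le0_of_le_mul _ _ (k / 2 * dotv w w)) => t t0 t1.
have := ymin _ (D_convex _ _ _ Dz Dy (ltW t0) t1).
have := convex_le z y f_convex (ltW t0) t1.
rewrite eq_constraint_conv hzE.
have -> : t *: (h y + w) + (1 - t) *: h y = h y + t *: w.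
  by apply/colP => i; rewrite !mxE; ring.
move: (h y) w {ymin hzE} => u w; rewrite !dotvE (dotvC w u) => h1 h2.
rewrite -(ler_pM2l t0); nra.
Qed.

(** Minimizers of the penalty problems with weights [k] give approximate
    multipliers. These are bounded: at the interior feasible point [xh], moved
    by a small multiple of a preimage of [- lam], the linear term of the
    Lagrangian is minus a multiple of the squared norm of [lam], whereas the
    Lagrangian is at least the minimum of [f] on a compact part [D] of [G]. As
    [k] grows, a limit point is a multiplier on [D], which contains all points
    of [G] close to [xs], hence on [G] by convexity. *)
Lemma multiplier_exists xs xh : closed G -> \rank A = p ->
  G xs -> h xs = 0 -> (forall y, G y -> h y = 0 -> f xs <= f y) ->
  nbhs xh G -> h xh = 0 ->
  exists lam, forall y, G y -> f xs <= f y + dotv lam (h y).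
Proof.
move=> G_closed rA Gxs hxs xsmin /nbhs_normP[r /= r0 Gr] hxh.
have [B AB] : exists B, A *m B = 1%:M by apply/row_freeP; rewrite /row_free rA.
have [C C0 BC] := mulmx_bounded B.
pose M := Num.max `|xs| `|xh| + 1.
have Mxs : `|xs| + 1 <= M by rewrite lerD2r le_max lexx.
have Mxh : `|xh| + 1 <= M by rewrite lerD2r le_max lexx orbT.
pose D := G `&` [set y | `|y| <= M].
have cD : compact D.
  by rewrite /D setIC; apply: compact_closedI => //; exact: compact_cV_ball.
have Dxs : D xs by split=> //=; apply: le_trans Mxs; rewrite lerDl.
have D_convex x y (t : R) : D x -> D y -> 0 <= t -> t <= 1 ->
    D (t *: x + (1 - t) *: y).
  move=> [Gx xM] [Gy yM] t0 t1; split; first exact: G_convex.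
  rewrite /= (le_trans (ler_normD _ _))// !normrZ.
  by rewrite ger0_norm// ger0_norm ?subr_ge0//; move: xM yM => /=; nra.
have f_cont := convex_continuous f_convex.
have f_contD : {within D, continuous f} by exact: continuous_subspaceT.
have D0 : D !=set0 by exists xs.
have [ymin _ fmin] := compact_EVT_min D0 cD f_contD.
have [ymax Dymax fmax] := compact_EVT_max D0 cD f_contD.
(* Any displacement of xh by at most rho stays in D. *)
pose rho := Num.min (r / 2) 1.
have rho0 : 0 < rho by rewrite lt_min ltr01 divr_gt0.
have Dxh d : `|d| <= rho -> D (xh + d).
  rewrite le_min => /andP[dr d1]; split.
    apply: Gr; rewrite /ball_/= opprD addrA subrr add0r normrN.
    by apply: le_lt_trans dr _; rewrite ltr_pdivrMr// ltr_pMr// ltr1n.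
  by apply: le_trans Mxh; rewrite (le_trans (ler_normD _ _))// lerD2l.
pose K := f ymax - f ymin.
(* When |lam| >= 1, moving xh by s *: (B *m lam) with s as below gives
   rho |lam|^2 <= K (|B *m lam| + 1) <= K (C + 1) |lam|. *)
pose L := K * (C + 1) / rho + 1.
have K0 : 0 <= K by rewrite subr_ge0 fmin.
have L0 : 0 < L by rewrite ltr_wpDl// divr_ge0 ?(ltW rho0)// mulr_ge0// addr_ge0.
have lamL y lam : D y -> (forall z, D z -> f y <= f z + dotv lam (h z)) ->
    `|lam| <= L.
  move=> Dy ylam; have [l1|l1] := leP `|lam| 1.
    by rewrite (le_trans l1)// lerDr divr_ge0 ?(ltW rho0)// mulr_ge0// addr_ge0.
  pose s := rho / (`|B *m lam| + 1).
  have s0 : 0 < s by rewrite divr_gt0// ltr_wpDl.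
  have sB : `|- (s *: (B *m lam))| <= rho.
    rewrite normrN normrZ gtr0_norm// /s mulrAC ler_pdivrMr ?ltr_wpDl//.
    by rewrite ler_wpM2l ?(ltW rho0)// lerDl.
  have hs : h (xh - s *: (B *m lam)) = - (s *: lam).
    rewrite /h /eq_constraint mulmxBr -scalemxAr mulmxA AB mul1mx.
    by rewrite addrAC -[A *m xh - b]/(h xh) hxh add0r.
  have := ylam _ (Dxh _ sB); rewrite hs !dotvE => h1.
  have h2 : f (xh - s *: (B *m lam)) <= f ymax.
    by apply: fmax; rewrite inE; exact: Dxh.
  have h3 : f ymin <= f y by apply: fmin; rewrite inE.
  have h4 : s * dotv lam lam <= K by rewrite /K; lra.
  have h5 : rho * `|lam| ^+ 2 <= K * (`|B *m lam| + 1).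
    move: h4; rewrite /s mulrAC ler_pdivrMr ?ltr_wpDl//; apply: le_trans.
    by rewrite ler_wpM2l ?(ltW rho0)// sqr_norm_le_dotv.
  have h6 : rho * `|lam| ^+ 2 <= K * (C + 1) * `|lam|.
    apply: le_trans h5 _; rewrite -mulrA ler_wpM2l// mulrDl mul1r.
    by rewrite lerD// ltW.
  suff : `|lam| <= K * (C + 1) / rho by rewrite /L; lra.
  rewrite ler_pdivlMr// -(@ler_pM2r _ `|lam|) ?(lt_trans _ l1)//.
  by rewrite mulrAC mulrC -expr2.
pose E e := [set z : 'cV[R]_n * 'cV[R]_p | [/\ D z.1, `|z.2| <= L, `|h z.1| <= e &
  forall y, D y -> f z.1 <= f y + dotv z.2 (h y)]].
have [||||[yb lb] [Dyb _] zE] :=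
    @compact_family_limit _ _ (D `*` [set l | `|l| <= L]) E.
- by apply: compact_setX => //; exact: compact_cV_ball.
- (* With this weight, |k h y| <= L means |h y| <= e. *)
  move=> e e0; pose k := L / e; have k0 : 0 < k by rewrite divr_gt0.
  pose q y := f y + k / 2 * dotv (h y) (h y).
  have [|y Dy ymink] := @compact_EVT_min _ _ q _ D0 cD.
    apply: continuous_subspaceT => x.
    apply: (@continuousD _ _ _ f (fun y => k / 2 * dotv (h y) (h y)) x).
      exact: f_cont.
    apply: continuousM; first exact: cst_continuous.
    by apply: dotv_continuous; exact: eq_constraint_continuous.
  rewrite inE in Dy.
  have ylam := penalty_optimality D_convex Dy
    (fun z Dz => ymink z (mem_set Dz)).
  have {}ylam z : D z -> f y <= f z + dotv (k *: h y) (h z).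
    by move=> /ylam; apply: le_trans; rewrite lerDl mulr_ge0 ?dotv_ge0 ?(ltW k0).
  have kL := lamL _ _ Dy ylam.
  exists (y, k *: h y); split=> //=.
  by move: kL; rewrite normrZ gtr0_norm// -ler_pdivlMl// /k invf_div divfK ?gt_eqF.
- by move=> e e' _ ee' z [z1 z2 z3 z4]; split=> //; exact: le_trans ee'.
- by move=> e z [].
have hyb : h yb = 0.
  apply/eqP; rewrite -normr_le0.
  apply: (@family_limit_le0 _ _ E (yb, lb) (fun z => `|h z.1|) 1) => //.
    apply: (@continuous_comp _ _ _ (h \o fst) Num.norm).
      by apply: continuous_comp; [exact: cvg_fst|exact: eq_constraint_continuous].
    exact: norm_continuous.
  by move=> e y _ [_ _]; rewrite mul1r.
have xsD y : D y -> f xs <= f y + dotv lb (h y).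
  move=> Dy; apply: le_trans (xsmin _ Dyb.1 hyb) _; rewrite -subr_le0.
  apply: (@family_limit_le0 _ _ E (yb, lb)
    (fun z => f z.1 - (f y + dotv z.2 (h y))) 0) => //.
    apply: (@continuousB _ _ _ (f \o fst)
      (fun z : 'cV[R]_n * 'cV[R]_p => f y + dotv z.2 (h y))).
      by apply: (@continuous_comp _ _ _ fst f); [exact: cvg_fst|exact: f_cont].
    apply: (@continuousD _ _ _ (fun=> f y)
      (fun z : 'cV[R]_n * 'cV[R]_p => dotv z.2 (h y))).
      exact: cst_continuous.
    by apply: dotv_continuous; [exact: cvg_snd|exact: cst_continuous].
  by move=> e z _ [_ _ _ /(_ _ Dy)]; rewrite mul0r subr_le0.
(* From D to G: the point at parameter t on the segment from xs to y is in D. *)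
exists lb => y Gy; pose t := (`|y - xs| + 1)^-1.
have t0 : 0 < t by rewrite invr_gt0 ltr_wpDl.
have tV : t * (`|y - xs| + 1) = 1 by rewrite mulVf// gt_eqF// ltr_wpDl.
have t1 : t <= 1 by rewrite invf_le1 ?lerDr ?ltr_wpDl.
have Dz : D (t *: y + (1 - t) *: xs).
  split; first by apply: G_convex => //; exact: ltW.
  have -> : t *: y + (1 - t) *: xs = xs + t *: (y - xs).
    by apply/colP => i; rewrite !mxE; ring.
  rewrite /= (le_trans (ler_normD _ _))// normrZ gtr0_norm//.
  by apply: le_trans Mxs; rewrite lerD2l -tV ler_wpM2l ?(ltW t0)// lerDl.
have := xsD _ Dz; have := convex_le y xs f_convex (ltW t0) t1.
rewrite eq_constraint_conv hxs scaler0 addr0 dotvZr => h1 h2.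
rewrite -(ler_pM2l t0); nra.
Qed.

End Multiplier.

(** * Monotonicity of absolutely continuous functions *)

Section AbsolutelyContinuous.
Context {R : realType}.
Implicit Types (W : R -> R) (s t : R).

Definition abs_continuousR s t W : Prop :=
  forall eps : R, 0 < eps -> exists2 delta : R, 0 < delta &
    forall (N : nat) (a b : 'I_N -> R),
      (forall i, [/\ s <= a i, a i <= b i & b i <= t]) ->
      trivIset [set: 'I_N] (fun i => `]a i, b i[%classic) ->
      \sum_(i < N) (b i - a i) < delta ->
      \sum_(i < N) `|W (b i) - W (a i)| < eps.

Lemma abs_continuousR_dominated {n p} (T s t C : R)
    (x : R -> 'cV[R]_n) (lam : R -> 'cV[R]_p) W :
  abs_continuous 0 T x -> abs_continuous 0 T lam -> 0 <= s -> t <= T ->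
  (forall u v, s <= u -> u <= v -> v <= t ->
    `|W v - W u| <= C * (`|x v - x u| + `|lam v - lam u| + (v - u))) ->
  abs_continuousR s t W.
Proof.
move=> acx acl s0 tT WC e e0.
have C1 : 0 < `|C| + 1 by rewrite ltr_wpDl.
pose e' := e / 3 / (`|C| + 1).
have e'0 : 0 < e' by rewrite !divr_gt0.
have [d1 d10 xd1] := acx _ e'0; have [d2 d20 ld2] := acl _ e'0.
exists (Num.min e' (Num.min d1 d2)); first by rewrite !lt_min e'0 d10.
move=> N a b ab dab; rewrite !lt_min => /and3P[ab0 ab1 ab2].
have ab' i : [/\ 0 <= a i, a i <= b i & b i <= T].
  by have [h1 h2 h3] := ab i; split=> //; [exact: le_trans h1|exact: le_trans tT].
have hx := xd1 N a b ab' dab ab1; have hl := ld2 N a b ab' dab ab2.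
apply: (@le_lt_trans _ _ ((`|C| + 1) * (\sum_(i < N) `|x (b i) - x (a i)| +
   \sum_(i < N) `|lam (b i) - lam (a i)| + \sum_(i < N) (b i - a i)))).
  rewrite -!big_split/= mulr_sumr; apply: ler_sum => i _.
  have [h1 h2 h3] := ab i; apply: le_trans (WC _ _ h1 h2 h3) _.
  apply: ler_wpM2r; first by apply: addr_ge0; [exact: addr_ge0|rewrite subr_ge0].
  by rewrite (le_trans (ler_norm _))// lerDl.
by move: hx hl ab0; rewrite /e' !ltr_pdivlMr//; nra.
Qed.

(** Two-sided form of a nonpositive derivative at [r], for intervals that
    contain [r] but need not have it as an end point. *)
Lemma straddle W (r l : R) :
  (fun h => h^-1 * (W (h + r) - W r)) @ 0^' --> l -> l <= 0 ->
  forall e, 0 < e -> exists2 d, 0 < d &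
    forall u v, r - d < u -> u <= r -> r <= v -> v < r + d ->
      W v - W u <= e * (v - u).
Proof.
move=> Wl l0 e e0.
move/cvgrPdist_lt : Wl => /(_ e e0)[d /= d0 dW].
have {}dW h : `|h| < d -> h != 0 -> h^-1 * (W (h + r) - W r) < e.
  move=> hd h0; have := dW h; rewrite /= sub0r normrN => /(_ hd h0).
  rewrite ltr_norml => /andP[]; lra.
exists d => // u v ru ur rv vr.
have h1 : W v - W r <= e * (v - r).
  have [->|vr'] := eqVneq v r; first by rewrite !subrr mulr0.
  have vr0 : 0 < v - r by rewrite subr_gt0 lt_neqAle eq_sym vr'.
  have := dW (v - r); rewrite subrK gtr0_norm// gt_eqF// => /(_ _ isT) h.
  by rewrite -ler_pdivrMr// mulrC ltW// h// ltrBlDl.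
have h2 : W r - W u <= e * (r - u).
  have [->|ur'] := eqVneq u r; first by rewrite !subrr mulr0.
  have ur0 : 0 < r - u by rewrite subr_gt0 lt_neqAle ur'.
  have ur1 : u - r != 0 by rewrite subr_eq0.
  have := dW (u - r); rewrite subrK distrC gtr0_norm// ur1 => /(_ _ isT) h.
  rewrite -ler_pdivrMr// mulrC ltW//.
  by rewrite -(opprB u r) invrN mulNr -mulrN opprB h// ltrBlDr -ltrBlDl.
lra.
Qed.

Lemma sum_length_le N (a b : 'I_N -> R) (U : set R) (m : R) : open U ->
  (forall i, a i <= b i) -> (forall i, `]a i, b i[%classic `<=` U) ->
  trivIset [set: 'I_N] (fun i => `]a i, b i[%classic) ->
  (@lebesgue_measure R U < m%:E)%E ->
  \sum_(i < N) (b i - a i) < m.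
Proof.
move=> oU ab abU dab mU; rewrite -lte_fin; apply: le_lt_trans mU.
have mab (i : 'I_N) : measurable (`]a i, b i[%classic : set R).
  exact: measurable_itv.
rewrite -sumEFin.
rewrite (eq_bigr (fun i => lebesgue_measure (`]a i, b i[%classic : set R))).
  rewrite -(@measure_semi_additive_ord _ _ _ lebesgue_measure)//.
    apply: le_measure; rewrite ?inE.
    - by apply: bigsetU_measurable => i _; exact: mab.
    - exact: measurable_realfun.open_measurable.
    - by apply: (big_ind (fun V => V `<=` U)) => [|V1 V2 ? ?|i _];
        [exact: sub0set|rewrite subUset|exact: abU].
  by apply: bigsetU_measurable => i _; exact: mab.
move=> i _; rewrite lebesgue_measure_itv/= lte_fin; case: ltP => // ba.
by rewrite (_ : a i = b i) ?subrr//; apply/le_anti; rewrite ab ba.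
Qed.

(** The bad points lie in an open set [U] of small measure. Moving from [s] to
    [t] by steps short enough for the point that they straddle, the increase of
    [W] is small relative to the length of a step around a good point; the
    steps around bad points are disjoint intervals contained in [U], over which
    absolute continuity bounds the total increase. A supremum argument shows
    that such steps reach [t]. *)
Lemma abs_continuousR_nonincreasing W s t : s <= t -> abs_continuousR s t W ->
  {ae (@lebesgue_measure R), forall r, s <= r -> r <= t ->
    forall e, 0 < e -> exists2 d, 0 < d &
      forall u v, r - d < u -> u <= r -> r <= v -> v < r + d ->
        W v - W u <= e * (v - u)} ->
  W t <= W s.
Proof.
move=> st acW [Z [mZ Z0 badZ]].
suff H e : 0 < e -> W t - W s <= e * (t - s + 1).
  rewrite -subr_le0; apply: (@le0_of_le_mul _ _ (t - s + 1)) => e e0 _.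
  exact: H.
move=> e0; have [delta delta0 Wdelta] := acW _ e0.
have [|U [oU ZU mU]] := lebesgue_regularity_outer mZ _ delta0.
  by move: Z0; rewrite /= => ->; exact: ltry.
have {}mU : (@lebesgue_measure R U < delta%:E)%E.
  apply: le_lt_trans mU; rewrite -[leRHS]add0e -Z0.
  apply: le_trans (measureU2 _ mZ _).
    rewrite le_measure ?inE//; first exact: measurable_realfun.open_measurable.
      apply: measurableU => //; apply: measurableD => //.
      exact: measurable_realfun.open_measurable.
    by move=> r Ur; have [Zr|nZr] := pselect (Z r); [left|right].
  by apply: measurableD => //; exact: measurable_realfun.open_measurable.
(* On [s, r] the increase of W is at most e (r - s), up to finitely many
   disjoint intervals contained in U. *)
pose P r := exists N (a b : 'I_N -> R),
  [/\ forall i, [/\ s <= a i, a i <= b i & b i <= r],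
      trivIset [set: 'I_N] (fun i => `]a i, b i[%classic),
      forall i, `]a i, b i[%classic `<=` U &
      W r - W s <= e * (r - s) + \sum_(i < N) `|W (b i) - W (a i)|].
have Ps : P s.
  exists 0, (fun=> 0), (fun=> 0); split=> [[]//||[]//|].
    by move=> [].
  by rewrite big_ord0 !subrr mulr0 addr0.
(* A step around a good point. *)
have Pgood u v : P u -> u <= v -> W v - W u <= e * (v - u) -> P v.
  move=> [N [a [b [ab dab abU Wab]]]] uv Wuv; exists N, a, b; split=> //.
    by move=> i; have [h1 h2 h3] := ab i; split=> //; exact: le_trans uv.
  lra.
(* A step around a bad point adds one interval to the family. *)
have Pbad u v : P u -> s <= u -> u <= v -> `]u, v[%classic `<=` U -> P v.
  move=> [N [a [b [ab dab abU Wab]]]] su uv uvU.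
  pose a' (i : 'I_N.+1) := if unlift ord0 i is Some j then a j else u.
  pose b' (i : 'I_N.+1) := if unlift ord0 i is Some j then b j else v.
  have dis j : `]a j, b j[%classic `&` `]u, v[%classic = set0 :> set R.
    apply/seteqP; split=> // r [] /=; rewrite !in_itv/= => /andP[_ h1] /andP[h2 _].
    by have [_ _ bju] := ab j; move: h1 h2 bju; lra.
  exists N.+1, a', b'; split.
  - move=> i; rewrite /a' /b'; case: unliftP => [j _|_]; last by split.
    by have [h1 h2 h3] := ab j; split=> //; exact: le_trans uv.
  - apply/trivIsetP => i k _ _; rewrite /a' /b'.
    case: unliftP => [j ->|->]; case: unliftP => [l ->|->].
    + by move=> jl; move/trivIsetP : dab => -> //; apply: contra jl => /eqP ->.
    + by rewrite dis.
    + by rewrite setIC dis.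
    + by rewrite eqxx.
  - by move=> i; rewrite /a' /b'; case: unliftP => [j _|_]; [exact: abU|].
  - rewrite big_ord_recl; under eq_bigr do rewrite /a' /b' liftK.
    rewrite /a' /b' unlift_none; have := ler_norm (W v - W u).
    have : 0 <= e * (v - u) by rewrite mulr_ge0 ?subr_ge0// ltW.
    move: Wab; set S := \sum_(_ < N) _; lra.
have step r : s <= r -> r <= t -> exists2 d, 0 < d & forall u v,
    P u -> s <= u -> r - d < u -> u <= r -> r <= v -> v < r + d -> P v.
  move=> sr rt; have [Zr|nZr] := pselect (Z r).
    have /nbhs_ballP[d /= d0 dU] : nbhs r U.
      by apply: open_nbhs_nbhs; split=> //; exact: ZU.
    exists d => // u v Pu su ru ur rv vr.
    apply: (Pbad u) => //; first exact: le_trans rv.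
    move=> q; rewrite /= in_itv/= => /andP[uq qv]; apply: dU.
    by rewrite -ball_normE /ball_/= ltr_norml; apply/andP; split; lra.
  have good : forall e, 0 < e -> exists2 d, 0 < d &
      forall u v, r - d < u -> u <= r -> r <= v -> v < r + d ->
        W v - W u <= e * (v - u).
    by apply: contrapT => bad; apply: nZr; apply: badZ => /(_ sr rt).
  have [d d0 Wd] := good e e0; exists d => // u v Pu su ru ur rv vr.
  by apply: (Pgood u) => //; [exact: le_trans rv|exact: Wd].
have Pt : P t.
  pose Q := [set r | [/\ s <= r, r <= t & P r]].
  have supQ : has_sup Q by split; [exists s|exists t => r []].
  pose r := sup Q.
  have sr : s <= r by apply: sup_upper_bound.
  have rt : r <= t by apply: ge_sup => [|q []]; first exact: supQ.1.
  have [d d0 Pd] := step r sr rt.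
  have [u [su ut Pu] ru] := sup_adherent d0 supQ.
  have ur : u <= r by apply: sup_upper_bound.
  pose v := Num.min t (r + d / 2).
  have rv : r <= v by rewrite le_min rt; lra.
  have vr : v < r + d by rewrite gt_min; apply/orP; right; lra.
  have Pv := Pd u v Pu su ru ur rv vr.
  have : v <= r.
    by apply: sup_upper_bound => //; split; [exact: le_trans rv|rewrite ge_min lexx|].
  by rewrite /v ge_min => /orP[tr|]; [|lra]; move: Pv; rewrite /v min_l//; lra.
have [N [a [b [ab dab abU Wab]]]] := Pt.
apply: le_trans Wab _; rewrite [leRHS]mulrDr mulr1 lerD2l ltW//; apply: Wdelta => //.
by apply: (@sum_length_le _ _ _ U) => // i; have [] := ab i.
Qed.

End AbsolutelyContinuous.

(** * Projections, boundedness of curves and derivative of the distance *)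

Section Projection.
Context {R : realType} {n : nat}.
Variable G : set 'cV[R]_n.
Hypothesis G_convex : forall x y (t : R), G x -> G y -> 0 <= t -> t <= 1 ->
  G (t *: x + (1 - t) *: y).

Lemma proj_variational y z w : is_proj G y z -> G w ->
  dotv (y - z) (w - z) <= 0.
Proof.
move=> [Gz zmin] Gw; set a := dotv _ _.
suff : 2 * a <= 0 by lra.
apply: (@le0_of_le_mul _ _ (dotv (w - z) (w - z))) => t t0 t1.
have := zmin _ (G_convex Gw Gz (ltW t0) t1).
have -> : y - (t *: w + (1 - t) *: z) = (y - z) - t *: (w - z).
  by apply/colP => i; rewrite !mxE; ring.
rewrite ler_norm2 {}/a; move: (y - z) (w - z) => u v.
rewrite !dotvE (dotvC v u) => h; rewrite -(ler_pM2l t0); lra.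
Qed.

(** Where [y] has no nearest point in [G], [euclid_proj G y] is [y] itself, and
    the inequality is trivial. *)
Lemma euclid_proj_variational y w : G w ->
  dotv (y - euclid_proj G y) (w - euclid_proj G y) <= 0.
Proof.
move=> Gw; rewrite /euclid_proj; case: xgetP => [z _ yz|_].
  exact: proj_variational.
by rewrite subrr dotv0l.
Qed.

(** Limit of the variational inequality for the projections of
    [x + delta *: xi]. *)
Lemma proj_tangent_normal x (K : set 'cV[R]_n) v : proj_tangent G x K v ->
  exists2 xi, K xi & forall y, G y -> dotv (xi - v) (y - x) <= 0.
Proof.
move=> [xi Kxi vE]; exists xi => // y Gy.
pose P d := euclid_proj G (x + d *: xi).
pose V d := d^-1 *: (P d - x).
have dV : d *: V d @[d --> 0^'+] --> 0 *: v.
  by apply: cvgZ => //; exact: cvg_at_right_filter.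
have lim : dotv (xi - V d) (y - x - d *: V d) @[d --> 0^'+] -->
    dotv (xi - v) (y - x - 0 *: v).
  by apply: cvg_dotv; apply: cvgB => //; exact: cvg_cst.
rewrite scale0r subr0 in lim.
apply: (cvgr_to_le lim); near=> d.
have d0 : 0 < d by near: d; exact: nbhs_right_gt.
have := euclid_proj_variational (x + d *: xi) Gy; rewrite -/(P d).
have -> : P d = x + d *: V d.
  by rewrite /V scalerA divff ?gt_eqF// scale1r addrC subrK.
have -> : x + d *: xi - (x + d *: V d) = d *: (xi - V d).
  by apply/colP => i; rewrite !mxE; ring.
by rewrite opprD addrA dotvZl pmulr_rle0.
Unshelve. all: by end_near. Qed.

End Projection.

(** The curve moves by at most [1] during each time step of length [d / 2]. *)
Lemma abs_continuous_bounded {R : realType} {n} (u : R -> 'cV[R]_n) (t : R) :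
  abs_continuous 0 t u ->
  exists B, forall s, 0 <= s -> s <= t -> `|u s| <= B.
Proof.
move=> /(_ 1 ltr01)[d d0 ud].
have ud1 a b : 0 <= a -> a <= b -> b <= t -> b - a < d -> `|u b - u a| <= 1.
  move=> a0 ab bt abd.
  have := ud 1 (fun=> a) (fun=> b); rewrite !big_ord1 => h; rewrite ltW// h//.
  by apply/trivIsetP => i j _ _; rewrite !ord1 eqxx.
have H (k : nat) s : 0 <= s -> s <= t -> s <= k%:R * (d / 2) ->
    `|u s - u 0| <= k%:R.
  elim: k s => [|k IH] s s0 st.
    rewrite mul0r => s0'; rewrite (_ : s = 0) ?subrr ?normr0//.
    by apply/le_anti; rewrite s0 s0'.
  rewrite -natr1 mulrDl mul1r => sk.
  pose s' := Num.max 0 (s - d / 2).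
  have s'0 : 0 <= s' by rewrite le_max lexx.
  have s's : s' <= s by rewrite ge_max s0/=; lra.
  have s'k : s' <= k%:R * (d / 2).
    by rewrite ge_max mulr_ge0 ?divr_ge0 ?(ltW d0)//=; lra.
  have ss' : s - s' < d.
    by have : s - d / 2 <= s' by [rewrite le_max lexx orbT]; lra.
  have h1 := IH s' s'0 (le_trans s's st) s'k.
  have h2 := ud1 s' s s'0 s's st ss'.
  rewrite -(subrKA (u s')) (le_trans (ler_normD _ _))// addrC lerD//.
pose k := Num.bound (t / (d / 2)).
exists (k%:R + `|u 0|) => s s0 st.
have d20 : 0 < d / 2 by rewrite divr_gt0.
rewrite -(subrK (u 0) (u s)) (le_trans (ler_normD _ _))// lerD2r H//.
rewrite (le_trans st)// -ler_pdivrMr// ltW// archi_boundP// divr_ge0 ?(ltW d20)//.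
exact: le_trans st.
Qed.

Section Energy.
Context {R : realType} {n : nat}.

Lemma sqr_dist_quotient (x : R -> 'cV[R]_n) y t :
  derivable x t 1 ->
  h^-1 * (dotv (x (h + t) - y) (x (h + t) - y) - dotv (x t - y) (x t - y))
    @[h --> 0^'] --> 2 * dotv (x t - y) (derive1 x t).
Proof.
move=> dx.
have q : h^-1 *: (x (h + t) - x t) @[h --> 0^'] --> derive1 x t.
  have := dx; rewrite /derivable /derive1.
  rewrite (_ : (fun h : R => h^-1 *: ((x \o shift t) (h *: 1) - x t)) =
               (fun h : R => h^-1 *: (x (h + t) - x t)))//.
  by apply/funext => h /=; rewrite [h *: 1]mulr1.
have cx : x (h + t) @[h --> 0^'] --> x t.
  have lim : x t + h *: (h^-1 *: (x (h + t) - x t)) @[h --> 0^'] -->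
      x t + 0 *: derive1 x t.
    apply: cvgD; first exact: cvg_cst.
    by apply: cvgZ => //; exact: nbhs_dnbhs.
  rewrite scale0r addr0 in lim; apply: cvg_trans lim; apply: near_eq_cvg.
  near=> h; have h0 : h != 0 by near: h; exact: nbhs_dnbhs_neq.
  by rewrite scalerA divff// scale1r addrC subrK.
have lim : dotv (h^-1 *: (x (h + t) - x t)) (x (h + t) - y + (x t - y))
    @[h --> 0^'] --> dotv (derive1 x t) (x t - y + (x t - y)).
  apply: cvg_dotv => //; apply: cvgD; last exact: cvg_cst.
  by apply: cvgB => //; exact: cvg_cst.
rewrite (_ : 2 * _ = dotv (derive1 x t) (x t - y + (x t - y))); last first.
  by rewrite dotvDr (dotvC (x t - y)); ring.
apply: cvg_trans lim; apply: near_eq_cvg; near=> h.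
rewrite dotvZl; congr (_ * _).
have -> : x (h + t) - x t = (x (h + t) - y) - (x t - y).
  by rewrite opprB addrA subrK.
move: (x (h + t) - y) (x t - y) => u v; rewrite !dotvE (dotvC v u); ring.
Unshelve. all: by end_near. Qed.

Lemma sqr_dist_dominated (x y z : 'cV[R]_n) (B : R) : `|x| <= B -> `|y| <= B ->
  `|dotv (x - z) (x - z) - dotv (y - z) (y - z)| <=
  n%:R * (2 * (B + `|z|)) * `|x - y|.
Proof.
move=> xB yB.
have -> : dotv (x - z) (x - z) - dotv (y - z) (y - z) =
    dotv (x - y) (x - z + (y - z)).
  have -> : x - y = (x - z) - (y - z) by rewrite opprB addrA subrK.
  by move: (x - z) (y - z) => u v; rewrite !dotvE (dotvC v u); ring.
apply: le_trans (dotv_bound _ _) _.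
rewrite -mulrA ler_wpM2l// mulrC ler_wpM2r//.
have := ler_normB x z; have := ler_normB y z.
have := ler_normD (x - z) (y - z); lra.
Qed.

End Energy.

(** * Convergence of the saddle-point dynamics *)

Lemma nbhs_forall_le0 {R : realType} {T : topologicalType} {m}
    (phi : 'I_m -> T -> R) (x : T) :
  (forall k, {for x, continuous (phi k)}) -> (forall k, phi k x < 0) ->
  nbhs x [set y | forall k, phi k y <= 0].
Proof.
move=> cphi phi0; apply: filter_forall => k.
by have /cvgr_lt /(_ _ (phi0 k)) := cphi k; apply: filterS => y; exact: ltW.
Qed.

Section InequalitySet.
Context {R : realType} {n m : nat}.
Variable g : 'cV[R]_n -> 'cV[R]_m.
Hypothesis g_convex : forall k : 'I_m,
  convex_function [set: 'cV[R]_n] (fun x => g x k ord0).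

Lemma ineq_set_convex x y (t : R) : ineq_set g x -> ineq_set g y ->
  0 <= t -> t <= 1 -> ineq_set g (t *: x + (1 - t) *: y).
Proof.
move=> Gx Gy t0 t1 k; apply: le_trans (convex_le x y (g_convex k) t0 t1) _.
by have := Gx k; have := Gy k; nra.
Qed.

Lemma ineq_set_closed : closed (ineq_set g).
Proof.
have -> : ineq_set g = \bigcap_k ((fun x => g x k ord0) @^-1` [set r | r <= 0]).
  by apply/seteqP; split=> [x Gx k _|x Gx k]; [exact: Gx|exact: (Gx k I)].
apply: closed_bigI => k _; apply: preimage_closed; last exact: closed_le.
by move=> x _; exact: (convex_continuous (g_convex k)).
Qed.

Lemma slater_interior x : (forall k, g x k ord0 < 0) -> nbhs x (ineq_set g).
Proof.
move=> gx; apply: (nbhs_forall_le0 (phi := fun k x => g x k ord0)) => // k.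
exact: (convex_continuous (g_convex k)).
Qed.

End InequalitySet.

Section Dynamics.
Context {R : realType} {n m p : nat}.
Variables (f : 'cV[R]_n -> R) (g : 'cV[R]_n -> 'cV[R]_m).
Variables (A : 'M[R]_(p, n)) (b : 'cV[R]_p) (mu : R).
Variables (x : R -> 'cV[R]_n) (lam : R -> 'cV[R]_p).
Hypothesis f_convex : convex_function [set: 'cV[R]_n] f.
Hypothesis g_convex : forall k : 'I_m,
  convex_function [set: 'cV[R]_n] (fun x => g x k ord0).
Hypothesis mu_gt0 : 0 < mu.
Hypothesis sol : saddle_solution f g A b mu x lam.

Let G := ineq_set g.
Let h := eq_constraint A b.

Definition energy y nu r :=
  (dotv (x r - y) (x r - y) + dotv (lam r - nu) (lam r - nu)) / 2.

(** Upper bound for the derivative of the energy along the dynamics, obtained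
    in [saddle_map_rate]. *)
Definition energy_rate y nu r :=
  f y - f (x r) + dotv (lam r) (h y) - dotv nu (h (x r))
  - mu^-1 * dotv (h (x r) - h y) (h (x r)).

Lemma energy_ge0 y nu r : 0 <= energy y nu r.
Proof. by rewrite divr_ge0// addr_ge0// dotv_ge0. Qed.

(** [proj_tangent_normal] allows the projected velocity to be replaced by an
    element of [saddle_map], for which the subgradient inequality applies. *)
Lemma saddle_map_rate y nu r v : G y ->
  proj_tangent G (x r) (saddle_map f A b mu (x r) (lam r)) v ->
  dotv (x r - y) v + dotv (lam r - nu) (h (x r)) <= energy_rate y nu r.
Proof.
move=> Gy /(proj_tangent_normal (ineq_set_convex g_convex))[_ [s sf <-]] /(_ y Gy).
have := sf y; rewrite /energy_rate -[A *m x r - b]/(h (x r)).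
have AE : A *m (x r - y) = h (x r) - h y.
  by rewrite /h /eq_constraint mulmxBr opprB addrA subrK.
have E1 u : dotv (A^T *m u) (x r - y) = dotv u (h (x r) - h y).
  by rewrite dotv_trmx AE.
rewrite -(opprB (x r) y); move: E1 {AE}.
move: (h (x r)) (h y) (x r - y) (lam r) => hx hy d l E1 h1.
rewrite !dotvNr !dotvDl !dotvNl !dotvZl !E1 (dotvC d v).
move: h1; rewrite !dotvE (dotvC hy hx) (dotvC l hx); lra.
Qed.

Lemma energy_quotient y nu r :
  derivable x r 1 -> derivable lam r 1 ->
  (fun d => d^-1 * (energy y nu (d + r) - energy y nu r)) @ 0^' -->
    dotv (x r - y) (derive1 x r) + dotv (lam r - nu) (derive1 lam r).
Proof.
move=> dx dl.
have qx := @sqr_dist_quotient _ _ x y r dx.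
have ql := @sqr_dist_quotient _ _ lam nu r dl.
rewrite (_ : _ + _ = 2^-1 * (2 * dotv (x r - y) (derive1 x r) +
  2 * dotv (lam r - nu) (derive1 lam r))); last by field.
have lim := cvgM (cvg_cst (2^-1 : R)) (cvgD qx ql).
rewrite (_ : (fun d => _) = (fun d : R => 2^-1 * (
    d^-1 * (dotv (x (d + r) - y) (x (d + r) - y) -
            dotv (x r - y) (x r - y)) +
    d^-1 * (dotv (lam (d + r) - nu) (lam (d + r) - nu) -
            dotv (lam r - nu) (lam r - nu))))); first exact: lim.
by apply/funext => d; rewrite /energy; ring.
Qed.

(** The bound of [saddle_map_rate] on the derivative holds only at almost every
    time; absolute continuity turns it into a bound on the increments. *)
Lemma energy_decrease y nu c s t : G y -> 0 <= s -> s <= t ->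
  (forall r, s <= r -> r <= t -> energy_rate y nu r <= c) ->
  energy y nu t - energy y nu s <= c * (t - s).
Proof.
move=> Gy s0 st ratec; pose W r := energy y nu r - c * r.
have t10 : 0 < t + 1 by rewrite ltr_wpDl// (le_trans s0).
have acx := saddle_solution_acx sol t10; have acl := saddle_solution_acl sol t10.
have [Bx xB] := abs_continuous_bounded acx.
have [Bl lB] := abs_continuous_bounded acl.
have t1 : t <= t + 1 by rewrite lerDl.
suff : W t <= W s by rewrite /W; lra.
apply: abs_continuousR_nonincreasing => //.
  pose C1 := n%:R * (2 * (Bx + `|y|)); pose C2 := p%:R * (2 * (Bl + `|nu|)).
  apply: (@abs_continuousR_dominated _ _ _ (t + 1) s t
    (`|C1| + `|C2| + `|c|) x lam) => // u v su uv vt.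
  have u0 : 0 <= u by exact: le_trans su.
  have v0 : 0 <= v by exact: le_trans uv.
  have ut1 : u <= t + 1 by exact: le_trans (le_trans uv vt) t1.
  have vt1 : v <= t + 1 by exact: le_trans vt t1.
  have h1 := @sqr_dist_dominated _ _ (x v) (x u) y Bx (xB _ v0 vt1) (xB _ u0 ut1).
  have h2 := @sqr_dist_dominated _ _ (lam v) (lam u) nu Bl
    (lB _ v0 vt1) (lB _ u0 ut1).
  have uv0 : 0 <= v - u by rewrite subr_ge0.
  have e1 : C1 * `|x v - x u| <= `|C1| * `|x v - x u|.
    by rewrite ler_wpM2r// ler_norm.
  have e2 : C2 * `|lam v - lam u| <= `|C2| * `|lam v - lam u|.
    by rewrite ler_wpM2r// ler_norm.
  rewrite -/C1 in h1; rewrite -/C2 in h2; clearbody C1 C2.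
  have -> : W v - W u =
      (dotv (x v - y) (x v - y) - dotv (x u - y) (x u - y)) / 2 +
      (dotv (lam v - nu) (lam v - nu) - dotv (lam u - nu) (lam u - nu)) / 2 -
      c * (v - u) by rewrite /W /energy; field.
  apply: le_trans (ler_normB _ _) _; rewrite normrM (ger0_norm uv0).
  apply: (le_trans (lerD (ler_normD _ _) (lexx _))).
  rewrite !normrM (@ger0_norm _ 2^-1)//.
  move: h1 h2; set X1 := dotv _ _ - _; set X2 := dotv _ _ - _.
  have X10 := normr_ge0 X1; have X20 := normr_ge0 X2.
  have k1a2 := mulr_ge0 (normr_ge0 C1) (normr_ge0 (lam v - lam u)).
  have k2a1 := mulr_ge0 (normr_ge0 C2) (normr_ge0 (x v - x u)).
  have k3a1 := mulr_ge0 (normr_ge0 c) (normr_ge0 (x v - x u)).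
  have k3a2 := mulr_ge0 (normr_ge0 c) (normr_ge0 (lam v - lam u)).
  have k1w := mulr_ge0 (normr_ge0 C1) uv0; have k2w := mulr_ge0 (normr_ge0 C2) uv0.
  lra.
have [Z [mZ Z0 goodZ]] := saddle_solution_ae sol.
exists Z; split=> // r bad; apply: goodZ => hr; apply: bad => sr rt.
have [dx dl xT lE] := hr (le_trans s0 sr).
pose l := dotv (x r - y) (derive1 x r) + dotv (lam r - nu) (derive1 lam r) - c.
apply: (@straddle _ W r l).
  have lim : d^-1 * (energy y nu (d + r) - energy y nu r) - c @[d --> 0^'] --> l.
    by apply: cvgB; [exact: energy_quotient|exact: cvg_cst].
  apply: cvg_trans lim; apply: near_eq_cvg; near=> d.
  have d0 : d != 0 by near: d; exact: nbhs_dnbhs_neq.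
  by rewrite /W; field.
have := saddle_map_rate nu Gy xT; have := ratec r sr rt.
by rewrite /l lE -/(h (x r)); lra.
Unshelve. all: by end_near. Qed.

(** A saddle point of the Lagrangian of the equality constraint on [G]. *)
Definition saddle_point xs ls : Prop :=
  [/\ G xs, h xs = 0 & forall y, G y -> f xs <= f y + dotv ls (h y)].

Lemma sol_in r : 0 <= r -> G (x r).
Proof. by move=> r0; exact: (saddle_solution_in sol). Qed.

(** The shift [w] of the dual centre is what [dual_drift] exploits; the energy
    centred at the saddle point itself is the case [w = 0]. *)
Lemma energy_rate_saddle xs ls w r : saddle_point xs ls -> 0 <= r ->
  energy_rate xs (ls - w) r <= dotv w (h (x r)) -
    mu^-1 * dotv (h (x r)) (h (x r)).
Proof.
move=> [Gxs hxs xsmin] r0; have := xsmin _ (sol_in r0).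
by rewrite /energy_rate hxs dotv0r addr0 subr0 !dotvDl dotvNl; lra.
Qed.

Lemma energy_nonincreasing xs ls s t : saddle_point xs ls ->
  0 <= s -> s <= t -> energy xs ls t <= energy xs ls s.
Proof.
move=> sad s0 st; have [Gxs _ _] := sad.
rewrite -subr_le0 -(mul0r (t - s)); apply: energy_decrease => // r sr rt.
have := energy_rate_saddle 0 sad (le_trans s0 sr).
rewrite subr0 dotv0l sub0r => /le_trans -> //.
by rewrite oppr_le0 mulr_ge0 ?invr_ge0 ?dotv_ge0 ?(ltW mu_gt0).
Qed.

Lemma energy_cauchy xs ls e : saddle_point xs ls -> 0 < e ->
  exists2 T, 0 <= T & forall s t, T <= s -> s <= t ->
    energy xs ls s - energy xs ls t <= e.
Proof.
move=> sad e0; pose Q := [set energy xs ls r | r in [set r | 0 <= r]].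
have Q0 : Q !=set0 by exists (energy xs ls 0), 0 => //=.
have infQ : has_inf Q by split=> //; exists 0 => _ [r _ <-]; exact: energy_ge0.
have [_ [T T0 <-] TQ] := inf_adherent e0 infQ.
exists T => // s t Ts st.
have := energy_nonincreasing sad T0 Ts.
have : inf Q <= energy xs ls t.
  apply: inf_lbound; first exact: infQ.2.
  by exists t => //=; exact: le_trans (le_trans T0 Ts) st.
lra.
Qed.

Lemma le_norm_energy (y : 'cV[R]_n) (nu : 'cV[R]_p) r (B : R) : 0 <= B ->
  2 * energy y nu r <= B ^+ 2 -> `|x r - y| <= B /\ `|lam r - nu| <= B.
Proof.
move=> B0; rewrite /energy => h1.
have := sqr_norm_le_dotv (x r - y); have := sqr_norm_le_dotv (lam r - nu).
have := dotv_ge0 (x r - y); have := dotv_ge0 (lam r - nu) => h2 h3 h4 h5.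
by split; rewrite -ler_sqr ?nnegrE//; lra.
Qed.

Lemma sol_bounded xs ls : saddle_point xs ls ->
  exists2 B, 0 <= B & forall t, 0 <= t -> `|x t| <= B /\ `|lam t| <= B.
Proof.
move=> sad; pose C := Num.sqrt (2 * energy xs ls 0).
have C0 : 0 <= C by exact: sqrtr_ge0.
exists (C + `|xs| + `|ls|); first by rewrite !addr_ge0.
move=> t t0; have [||h1 h2] := @le_norm_energy xs ls t C => //.
  rewrite sqr_sqrtr; last by apply: mulr_ge0 => //; exact: energy_ge0.
  by rewrite ler_wpM2l//; exact: energy_nonincreasing.
have h3 := ler_normD (x t - xs) xs; have h4 := ler_normD (lam t - ls) ls.
rewrite !subrK in h3 h4.
by have := normr_ge0 xs; have := normr_ge0 ls; split; lra.
Qed.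

(** The energy cannot decrease at a positive rate forever, so its rate is
    arbitrarily close to zero at arbitrarily large times; a limit point of the
    curve along such times is a minimizer. *)
Lemma sol_limit_point xs ls : saddle_point xs ls ->
  exists xb lb, [/\ G xb, h xb = 0, f xb = f xs &
    forall e T, 0 < e -> exists t,
      [/\ 0 <= t, T <= t, `|x t - xb| < e & `|lam t - lb| < e]].
Proof.
move=> sad; have [Gxs hxs xsmin] := sad.
have [B B0 xB] := sol_bounded sad.
pose D y := f y - f xs + dotv ls (h y) + mu^-1 * dotv (h y) (h y).
have Drate r : energy_rate xs ls r = - D (x r).
  by rewrite /D /energy_rate hxs dotv0r addr0 subr0; ring.
pose E e := [set z : 'cV[R]_n * 'cV[R]_p |
  exists t, [/\ e^-1 <= t, 0 <= t, z = (x t, lam t) & D (x t) <= e]].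
have [||||[xb lb] [[/= Gxb _] _] zE] := @compact_family_limit _ _
    ((G `&` [set y | `|y| <= B]) `*` [set l | `|l| <= B]) E.
- apply: compact_setX; last exact: compact_cV_ball.
  rewrite setIC; apply: compact_closedI; first exact: compact_cV_ball.
  exact: ineq_set_closed.
- (* Otherwise the energy decreases at the rate e from the time s on, and is
     negative at the time t. *)
  move=> e e0; apply: contrapT => E0.
  pose s := e^-1; have s0 : 0 <= s by rewrite invr_ge0 ltW.
  pose t := s + (energy xs ls s + 1) / e.
  have st : s <= t.
    by rewrite lerDl divr_ge0 ?(ltW e0)// addr_ge0//; exact: energy_ge0.
  have : energy xs ls t - energy xs ls s <= - e * (t - s).
    apply: energy_decrease => // r sr rt.
    rewrite Drate lerN2 leNgt; apply/negP => De; apply: E0.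
    exists (x r, lam r), r; split=> //; first exact: le_trans sr.
    exact: ltW.
  have -> : - e * (t - s) = - (energy xs ls s + 1).
    by rewrite /t addrAC subrr add0r mulNr mulrC divfK// gt_eqF.
  by have := energy_ge0 xs ls t; lra.
- move=> e e' e0 ee' z [t [et t0 zt De]]; exists t; split=> //.
    by apply: le_trans et; rewrite lef_pV2 ?posrE// (lt_le_trans e0).
  exact: le_trans ee'.
- move=> e z [t [_ t0 -> _]]; have [h1 h2] := xB t t0.
  by split=> //; split=> //; exact: sol_in.
have hc := @eq_constraint_continuous _ _ _ A b.
have fc := convex_continuous f_convex.
have Dc : continuous D.
  move=> y; apply: (@continuousD _ _ _ (fun y => f y - f xs + dotv ls (h y))
    (fun y => mu^-1 * dotv (h y) (h y))).
    apply: (@continuousD _ _ _ (fun y => f y - f xs) (fun y => dotv ls (h y))).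
      by apply: (@continuousB _ _ _ f (fun=> f xs));
        [exact: fc|exact: cst_continuous].
    by apply: dotv_continuous; [exact: cst_continuous|exact: hc].
  apply: continuousM; first exact: cst_continuous.
  by apply: dotv_continuous; exact: hc.
have Dxb : D xb <= 0.
  apply: (@family_limit_le0 _ _ E (xb, lb) (D \o fst) 1) => //.
    by apply: continuous_comp; [exact: cvg_fst|exact: Dc].
  by move=> e z _ [t [_ _ -> De]]; rewrite mul1r.
have mhh : 0 <= mu^-1 * dotv (h xb) (h xb).
  by rewrite mulr_ge0 ?dotv_ge0// invr_ge0 ltW.
have hxb : h xb = 0.
  apply: dotv_eq0; have := xsmin _ Gxb; move: Dxb; rewrite /D => h1 h2.
  by rewrite -(@pmulr_rle0 _ mu^-1) ?invr_gt0//; lra.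
have fxb : f xb = f xs.
  have := xsmin _ Gxb; move: Dxb; rewrite /D hxb !dotv0r mulr0 !addr0.
  by rewrite subr_le0 => h1 h2; apply/le_anti; rewrite h1 h2.
exists xb, lb; split=> // e T e0.
(* The index e1 of E bounds the distance by e and the time from below by T. *)
pose e1 := Num.min e (Num.max T 1)^-1.
have T1 : 0 < Num.max T 1 by rewrite lt_max ltr01 orbT.
have e10 : 0 < e1 by rewrite lt_min e0 invr_gt0.
have [z [t [e1t t0 -> _]]] := zE _ e10.
rewrite prod_normE/= gt_max => /andP[h1 h2]; exists t; split=> //.
- apply: le_trans e1t; rewrite (@le_trans _ _ (Num.max T 1)) ?le_max ?lexx//.
  by rewrite -[leLHS]invrK lef_pV2 ?posrE// ?invr_gt0// ge_min lexx orbT.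
- by rewrite distrC (lt_le_trans h1)// ge_min lexx.
- by rewrite distrC (lt_le_trans h2)// ge_min lexx.
Qed.

(** Shifting the dual centre of the energy by a small multiple of [u] costs a
    small positive rate, and makes the energy see the motion of [lam] along
    [u]; the energy itself is nearly constant at large times. *)
Lemma dual_drift xs ls u T e : saddle_point xs ls -> 0 < e -> 0 <= T ->
  exists2 T0, 0 <= T0 & forall s t, T0 <= s -> s <= t -> t <= s + T ->
    dotv (lam t) u <= dotv (lam s) u + e.
Proof.
move=> sad e0 TT0; have [Gxs _ _] := sad.
pose K := mu * dotv u u * T.
have K0 : 0 <= K by rewrite mulr_ge0// mulr_ge0 ?dotv_ge0// ltW.
pose sg := e / (K + 1).
have sg0 : 0 < sg by rewrite divr_gt0// ltr_wpDl.
have sgK : sg * K <= e.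
  by rewrite /sg mulrAC ler_pdivrMr ?ltr_wpDl// ler_wpM2l ?(ltW e0)// lerDl.
have [T0 T00 VT0] := energy_cauchy sad (mulr_gt0 sg0 e0).
exists T0 => // s t T0s st tT; pose w := (2 * sg) *: u.
have s0 : 0 <= s by exact: le_trans T0s.
have h1 : energy xs (ls - w) t - energy xs (ls - w) s <=
    (mu * sg ^+ 2 * dotv u u) * (t - s).
  apply: energy_decrease => // r sr rt.
  apply: le_trans (energy_rate_saddle _ sad (le_trans s0 sr)) _.
  (* The difference of the two sides is the squared norm of a vector over mu. *)
  have muV0 : 0 < mu^-1 by rewrite invr_gt0.
  have := dotv_ge0 (h (x r) - (mu * sg) *: u); rewrite -(pmulr_rge0 _ muV0).
  rewrite /w; move: (h (x r)) => v; rewrite !dotvE (dotvC v u).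
  move=> sq0; rewrite -subr_ge0 (le_trans sq0)// le_eqVlt.
  by apply/orP; left; apply/eqP; field; rewrite gt_eqF.
have h2 r : energy xs (ls - w) r =
    energy xs ls r + 2 * sg * (dotv (lam r) u - dotv ls u) + dotv w w / 2.
  rewrite /energy opprB addrA (addrAC _ w) /w; move: (x r - xs) (lam r) => v l.
  by rewrite !dotvE (dotvC u l) (dotvC u ls); field.
have h3 := VT0 s t T0s st; rewrite !h2 in h1.
have h4 : (mu * sg ^+ 2 * dotv u u) * (t - s) <= sg * e.
  apply: (@le_trans _ _ ((mu * sg ^+ 2 * dotv u u) * T)).
    apply: ler_wpM2l; last by lra.
    by apply: mulr_ge0; [rewrite mulr_ge0 ?sqr_ge0// ltW|exact: dotv_ge0].
  have -> : mu * sg ^+ 2 * dotv u u * T = sg * (sg * K) by rewrite /K; ring.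
  by rewrite ler_wpM2l// ltW.
have : sg * (dotv (lam t) u - dotv (lam s) u) <= sg * e by lra.
by rewrite ler_pM2l//; lra.
Qed.

(** If the Lagrangian inequality failed at [y] for the limit [lb], it would
    fail for [lam] on long time intervals that start near the limit; with the
    dual centre [ls + mu^-1 *: h y] the energy would decrease there at a fixed
    rate and become negative. *)
Lemma limit_multiplier xs ls lb : saddle_point xs ls ->
  (forall e T, 0 < e -> exists t, [/\ 0 <= t, T <= t & `|lam t - lb| < e]) ->
  forall y, G y -> f xs <= f y + dotv lb (h y).
Proof.
move=> sad lamlb y Gy; rewrite leNgt; apply/negP => gap0.
have [Gxs hxs xsmin] := sad.
have [B B0 xB] := sol_bounded sad.
have [u uE] : exists u, h y = u by exists (h y).
rewrite uE in gap0; pose dl := f xs - (f y + dotv lb u).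
have dl0 : 0 < dl by rewrite subr_gt0.
pose nu := ls + mu^-1 *: u.
pose C := n%:R * (B + `|y|) ^+ 2 + p%:R * (B + `|nu|) ^+ 2.
have C0 : 0 <= C by rewrite addr_ge0// mulr_ge0// sqr_ge0.
have energyC r : 0 <= r -> energy y nu r <= C.
  move=> r0; have [h1 h2] := xB r r0.
  have b1 : dotv (x r - y) (x r - y) <= n%:R * (B + `|y|) ^+ 2.
    apply: le_trans (ler_norm _) _; apply: le_trans (dotv_bound _ _) _.
    have h3 := ler_normB (x r) y; rewrite ler_wpM2l// expr2 ler_pM//; lra.
  have b2 : dotv (lam r - nu) (lam r - nu) <= p%:R * (B + `|nu|) ^+ 2.
    apply: le_trans (ler_norm _) _; apply: le_trans (dotv_bound _ _) _.
    have h3 := ler_normB (lam r) nu; rewrite ler_wpM2l// expr2 ler_pM//; lra.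
  have := dotv_ge0 (x r - y); have := dotv_ge0 (lam r - nu).
  by rewrite /energy /C; lra.
(* A decrease at the rate dl / 2 for a time T exceeds the bound C. *)
pose T := (C + 1) * 2 / dl.
have T0 : 0 <= T by rewrite divr_ge0 ?(ltW dl0)// mulr_ge0// addr_ge0.
have [T1 T10 drift] := dual_drift u sad (divr_gt0 dl0 (ltr0n _ 4)) T0.
pose e := dl / 4 / (p%:R * `|u| + 1).
have pu0 : 0 < p%:R * `|u| + 1 by rewrite ltr_wpDl// mulr_ge0.
have e0 : 0 < e by rewrite !divr_gt0.
have [s [s0 T1s lams]] := lamlb e T1 e0.
have lams_u : dotv (lam s) u <= dotv lb u + dl / 4.
  have := le_trans (ler_norm _) (dotv_bound (lam s - lb) u).
  rewrite dotvDl dotvNl.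
  have h1 : (p%:R * `|u| + 1) * e = dl / 4 by rewrite mulrC divfK// gt_eqF.
  have h2 : p%:R * (`|lam s - lb| * `|u|) <= p%:R * `|u| * e.
    by rewrite mulrCA mulrC ler_wpM2l ?mulr_ge0// ltW.
  lra.
have st : s <= s + T by rewrite lerDl.
have : energy y nu (s + T) - energy y nu s <= - (dl / 2) * (s + T - s).
  apply: energy_decrease => // r sr rt.
  have h1 := drift s r T1s sr rt.
  have h2 := xsmin _ (sol_in (le_trans s0 sr)).
  have h3 : 0 <= mu^-1 * dotv (h (x r)) (h (x r)).
    by rewrite mulr_ge0 ?dotv_ge0// invr_ge0 ltW.
  rewrite /energy_rate uE /nu; move: h2 h3.
  move: (h (x r)) => v h2 h3; rewrite !dotvE.
  by move: h1 lams_u; rewrite /dl; lra.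
have -> : - (dl / 2) * (s + T - s) = - (C + 1).
  by rewrite /T; field; rewrite gt_eqF.
by have := energy_ge0 y nu (s + T); have := energyC s s0; lra.
Qed.

(** The limit point is itself a saddle point, so the energy centred there is
    nonincreasing; it is small at one time, hence at all later times. *)
Lemma saddle_dynamics_cvg xs ls : saddle_point xs ls ->
  exists z : 'cV[R]_n * 'cV[R]_p, [/\ G z.1, h z.1 = 0, f z.1 = f xs &
    (fun t => (x t, lam t)) @ +oo --> z].
Proof.
move=> sad; have [xb [lb [Gxb hxb fxb near_b]]] := sol_limit_point sad.
have sadb : saddle_point xb lb.
  split=> // y; rewrite fxb; apply: (limit_multiplier sad) => e T e0.
  by have [t [t0 Tt _ le]] := near_b e T e0; exists t.
exists (xb, lb); split=> //; apply/cvgrPdist_lt => /= e e0.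
pose e1 := e / 2 / (n%:R + p%:R + 1).
have np0 : 0 < (n%:R + p%:R + 1 : R) by rewrite ltr_wpDl// addr_ge0.
have e10 : 0 < e1 by rewrite !divr_gt0.
have [s [s0 _ xe le]] := near_b e1 0 e10.
have sE : 2 * energy xb lb s <= (e / 2) ^+ 2.
  have h1 := le_trans (ler_norm _) (dotv_bound (x s - xb) (x s - xb)).
  have h2 := le_trans (ler_norm _) (dotv_bound (lam s - lb) (lam s - lb)).
  have h3 : `|x s - xb| * `|x s - xb| <= e1 ^+ 2 by rewrite expr2 ler_pM// ltW.
  have h4 : `|lam s - lb| * `|lam s - lb| <= e1 ^+ 2.
    by rewrite expr2 ler_pM// ltW.
  have h5 : n%:R * (`|x s - xb| * `|x s - xb|) <= n%:R * e1 ^+ 2.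
    by rewrite ler_wpM2l.
  have h6 : p%:R * (`|lam s - lb| * `|lam s - lb|) <= p%:R * e1 ^+ 2.
    by rewrite ler_wpM2l.
  have -> : e / 2 = (n%:R + p%:R + 1) * e1 by rewrite [RHS]mulrC divfK// gt_eqF.
  rewrite /energy exprMn; set N := (n%:R + p%:R + 1 : R) in np0 *.
  have N1 : 1 <= N by rewrite /N lerDr addr_ge0.
  have h7 : N * e1 ^+ 2 <= N ^+ 2 * e1 ^+ 2.
    by rewrite ler_wpM2r ?sqr_ge0// expr2 ler_peMr// ltW.
  move: h7; rewrite {1}/N; have := sqr_ge0 e1; lra.
near=> t.
have st : s <= t by near: t; apply: nbhs_pinfty_ge; exact: num_real.
have [||h1 h2] := @le_norm_energy xb lb t (e / 2).
- by rewrite divr_ge0// ltW.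
- apply: le_trans sE; rewrite ler_wpM2l//.
  exact: energy_nonincreasing.
rewrite prod_normE/= gt_max !(distrC _ (x t)) !(distrC _ (lam t)).
by apply/andP; split; lra.
Unshelve. all: by end_near. Qed.

End Dynamics.

Theorem corollary4p3 (R : realType) (n m p : nat) (p_le_n : (p <= n)%N)
    (f : 'cV[R]_n -> R) (g : 'cV[R]_n -> 'cV[R]_m)
    (A : 'M[R]_(p, n)) (b : 'cV[R]_p) (mu : R)
    (f_convex : convex_function [set: 'cV[R]_n] f)
    (g_convex : forall k : 'I_m,
      convex_function [set: 'cV[R]_n] (fun x => g x k ord0))
    (S_nonempty : solution_set f g A b !=set0)
    (S_bounded : bounded_set (solution_set f g A b))
    (rankA : \rank A = p)
    (slater : exists x : 'cV[R]_n,
      eq_constraint A b x = 0 /\ forall k : 'I_m, g x k ord0 < 0)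
    (mu_gt0 : 0 < mu)
    (x : R -> 'cV[R]_n) (lam : R -> 'cV[R]_p)
    (sol : saddle_solution f g A b mu x lam) :
  exists2 z : 'cV[R]_n * 'cV[R]_p,
    (solution_set f g A b `*` [set: 'cV[R]_p]) z &
    (fun t : R => (x t, lam t)) @ +oo --> z.
Proof.
have [xs [[hxs Gxs] fxs]] := S_nonempty.
have [xh [hxh gxh]] := slater.
have xsmin y : ineq_set g y -> eq_constraint A b y = 0 -> f xs <= f y.
  move=> Gy hy; rewrite -lee_fin fxs; apply: ereal_inf_lbound.
  by exists y.
have [ls lsmin] := multiplier_exists f_convex (ineq_set_convex g_convex)
  (ineq_set_closed g_convex) rankA Gxs hxs xsmin
  (slater_interior g_convex gxh) hxh.
have sad : saddle_point f g A b xs ls by split.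
have [z [Gz hz fz zlim]] :=
  saddle_dynamics_cvg f_convex g_convex mu_gt0 sol sad.
by exists z => //; split=> //; split=> //; rewrite fz.
Qed.
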